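(* Let $a\ge\mu>0$, $\gamma>0$, $\alpha\ge1$, $\rho\ge0$, and set $\tau=\frac1\alpha+\frac\mu\gamma$, $s=1+\tau$, $\lambda=\frac{\alpha}{\gamma s}$, $r=\frac1{1+\lambda a}$, $$a_1=\frac{r\tau}{s},\quad b_1=\frac rs,\quad c_1=\Big(1+\frac1\alpha\Big)a_1-\frac1\alpha,\quad d_1=\Big(1+\frac1\alpha\Big)b_1,\quad M=\begin{pmatrix} a_1 & b_1 \\ c_1 & d_1 \end{pmatrix},\quad g=r\begin{pmatrix} 1 \\ 1+\frac1\alpha \end{pmatrix}.$$ Consider the recursion $z_{k+1}=Mz_k+g\,\xi_k$ in $\mathbb{R}^2$, with $z_k=(e_k,w_k)^\top$ and $\xi_k$ as in the context, and assume the recursion is stable. Then at stationarity the mean is zero and the covariance $P=\mathbb{E}[z_kz_k^\top]=\begin{pmatrix} p_{11} & p_{12} \\ p_{12} & p_{22} \end{pmatrix}$ satisfies the discrete Lyapunov equation $$P=MPM^\top+Q,\qquad Q=\mathrm{Var}(\xi_k)\,gg^\top,$$ and the stationary mean-square error is $\mathbb{E}[e_k^2]=p_{11}$. Equivalently, $(p_{11},p_{12},p_{22})$ satisfies $$\begin{pmatrix} 1-a_1^2 & -2a_1b_1 & -b_1^2 \\ -a_1c_1 & 1-(a_1d_1+b_1c_1) & -b_1d_1 \\ -c_1^2 & -2c_1d_1 & 1-d_1^2 \end{pmatrix}\begin{pmatrix} p_{11} \\ p_{12} \\ p_{22} \end{pmatrix}=\begin{pmatrix} q_{11} \\ q_{12}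 \\ q_{22} \end{pmatrix},$$ where $q_{11}=\frac{\alpha\rho^2}{s^2}r^2$, $q_{12}=\frac{\alpha\rho^2}{s^2}r^2\big(1+\frac1\alpha\big)$, $q_{22}=\frac{\alpha\rho^2}{s^2}r^2\big(1+\frac1\alpha\big)^2$.
   Context: The $\xi_k$ are independent centered Gaussian real random variables with $\mathrm{Var}(\xi_k)=\alpha\rho^2/s^2$, and $\xi_k$ is independent of $z_0,\dots,z_k$. ''Stable'' means the spectral radius of $M$ is less than $1$; ''at stationarity'' means $z_k$ is distributed according to the stationary law of the recursion. (This recursion is the error dynamics, along one eigenvector with eigenvalue $a$ of the Hessian of a quadratic objective, of the fully implicit scheme with isotropic noise: $e_k$ is the position error and $w_k$ the auxiliary-velocity error.) *)

(* Defs.v *)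
From HB Require Import structures.
From mathcomp Require Import all_boot all_order all_algebra.
From mathcomp Require Import all_classical all_reals all_analysis.
From mathcomp Require Import complex.

Set Implicit Arguments.
Unset Strict Implicit.
Unset Printing Implicit Defensive.
Import Order.TTheory GRing.Theory Num.Theory.

Local Open Scope classical_set_scope.
Local Open Scope ring_scope.

(* Matrices and columns given by the list of their rows, resp. entries. *)
Definition mxof (R : nzRingType) (m n : nat) (rows : seq (seq R)) : 'M[R]_(m, n) :=
  \matrix_(i < m, j < n) nth 0 (nth [::] rows i) j.

Definition colof (R : nzRingType) (m : nat) (s : seq R) : 'cV[R]_m :=
  \col_(i < m) nth 0 s i.

(* Maximal modulus of the complex eigenvalues; the set is finite, so the sup is
   attained. *)
Definition spectral_radius (R : realType) (n : nat) (A : 'M[R]_n) : R :=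
  sup [set ComplexField.Normc.normc c | c in [set c : R[i] |
    eigenvalue (map_mx (real_complex R) A) c]].

(* Gaussian law with mean m and variance v >= 0. The case v = 0 has to be split
   off, because normal_prob m 0 is the uniform law on [0, 1], not \d_m. It is a
   bare set function because normal_prob carries its probability structure on
   measurableTypeR R, whose display differs from that of R. *)
Definition gaussian_law (R : realType) (m v : R) : set R -> \bar R :=
  if v == 0 then \d_m else normal_prob m (Num.sqrt v).

(* Random vectors in R^2 take values in R * R, which carries the product
   sigma-algebra; matrices act on the corresponding columns. *)
Definition col2 (R : nzRingType) (x : R * R) : 'cV[R]_2 := colof 2 [:: x.1; x.2].

Definition recursion_step (R : realType) (M : 'M[R]_2) (g : 'cV[R]_2)
    (x : R * R) (u : R) : R * R :=
  let y := M *m col2 x + u *: g in (y 0 0, y 1 0).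

(* nu is invariant under the Markov transition x |-> M x + g u, u ~ noise. *)
Definition is_stationary_law (R : realType) (M : 'M[R]_2) (g : 'cV[R]_2)
    (noise : set R -> \bar R) (nu : probability (R * R)%type R) : Prop :=
  forall B : set (R * R), measurable B ->
    (\int[nu]_x noise (recursion_step M g x @^-1` B) = nu B)%E.

Section Probability.
Context (d : measure_display) (T : measurableType d) (R : realType).
Variable P : probability T R.

Definition independent_pair (d1 d2 : measure_display)
    (T1 : measurableType d1) (T2 : measurableType d2)
    (X : T -> T1) (Y : T -> T2) : Prop :=
  forall (A : set T1) (B : set T2), measurable A -> measurable B ->
    (P (X @^-1` A `&` Y @^-1` B) = P (X @^-1` A) * P (Y @^-1` B))%E.

Definition mutually_independent (d1 : measure_display)
    (T1 : measurableType d1) (X : nat -> T -> T1) : Prop :=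
  forall (s : seq nat) (A : nat -> set T1), uniq s ->
    (forall i, measurable (A i)) ->
    (P (\bigcap_(i in [set` s]) (X i @^-1` A i)) =
     \prod_(i <- s) P (X i @^-1` A i))%E.

Definition covariance_mx (n : nat) (Z : T -> 'cV[R]_n) : 'M[R]_n :=
  \matrix_(i, j) fine (covariance P (fun t => Z t i 0) (fun t => Z t j 0)).

Definition expectation_mx (m n : nat) (Z : T -> 'M[R]_(m, n)) : 'M[R]_(m, n) :=
  \matrix_(i, j) fine 'E_P[fun t => Z t i j]%E.

End Probability.

(* Main.v *)
Require Import Defs.
From HB Require Import structures.
From mathcomp Require Import all_boot all_order all_algebra.
From mathcomp Require Import all_classical all_reals all_analysis.

From mathcomp Require Import measurable_realfun ring lra.

Set Implicit Arguments.
Unset Strict Implicit.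
Unset Printing Implicit Defensive.
Import Order.TTheory GRing.Theory Num.Theory.
Local Open Scope classical_set_scope.
Local Open Scope ring_scope.

(** Let nu be the law of z_k and eta the Gaussian law of xi_k. Stationarity says
    that nu is the image of nu x eta under the step (x, u) |-> M x + g u. Hence,
    for f integrable under nu, Fubini gives
      int f(x) nu(dx) = int (int f(M x + g u) eta(du)) nu(dx),
    where the inner integral is explicit when f is a polynomial of degree at
    most 2, because the moments 0 and v of eta are known
    (has_mean_stationary). Taking for f the coordinates gives m = M m for the
    mean m of nu; taking products of two coordinates gives
    S = M S M^T + v g g^T for the matrix S of second moments
    (stationary_mean, stationary_second_moment). Since I - M has determinant
    1 - r > 0, the mean vanishes and S is the covariance matrix. The 3 x 3 system
    is the entrywise form of the matrix equation (lyapunov_system).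

    The substance is that nu has finite second moments, which stationarity does
    not assert. In the variables e and y = alpha (w - e) the step is an implicit
    scheme, and the energy V = y^2 + c e^2 with c = lambda a satisfies
    V(x') <= k V(x) + C u^2 with k = (1 + c/2) / (1 + c) < 1
    (energy_contraction). Under a stationary law V(x') and V(x) have the same
    distribution, so one would like to take expectations and conclude
    (1 - k) E[V] <= C v, but this subtracts E[V] from itself before it is known to be
    finite. Truncating at level n first makes the subtraction legitimate, and
    monotone convergence removes the truncation (drift_has_mean).

    The first two moments of the normal law come from the fact that the ratio of
    two normal densities has mean 1 and is the exponential of a quadratic
    polynomial, hence is bounded below by an affine function of x and x^2
    (normal_moments). *)

(** * Functions with a given mean *)

Section HasMean.
Context (d : measure_display) (T : measurableType d) (R : realType).
Variable P : probability T R.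

(** Integrability is required because the integral of a non-integrable function is a
    junk value; with it, means are linear and monotone. *)
Definition has_mean (f : T -> R) (c : R) : Prop :=
  P.-integrable setT (EFin \o f) /\ (\int[P]_x (f x)%:E = c%:E)%E.

Lemma has_mean_unique f b c : has_mean f b -> has_mean f c -> b = c.
Proof. by move=> [_ fb] [_]; rewrite fb => -[]. Qed.

Lemma has_mean_ext f h b c : f =1 h -> b = c -> has_mean f b -> has_mean h c.
Proof. by move=> /funext -> ->. Qed.

Lemma has_mean_cst c : has_mean (cst c) c.
Proof.
split; first exact: finite_measure_integrable_cst.
by have := expectation_cst P c; rewrite unlock.
Qed.

Lemma has_meanD f h b c :
  has_mean f b -> has_mean h c -> has_mean (fun x => f x + h x) (b + c).
Proof.
move=> [fi fE] [hi hE]; split; first exact: (integrableD measurableT fi hi).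
by under eq_integral do rewrite EFinD; rewrite integralD//= fE hE.
Qed.

Lemma has_meanZ k f b : has_mean f b -> has_mean (fun x => k * f x) (k * b).
Proof.
move=> [fi fE]; split; first exact: (integrableZl measurableT k fi).
by under eq_integral do rewrite EFinM; rewrite integralZl//= fE.
Qed.

Lemma has_mean_le f h b c : (forall x, f x <= h x) ->
  has_mean f b -> has_mean h c -> b <= c.
Proof.
move=> fh [fi fE] [hi hE]; rewrite -lee_fin -fE -hE.
by apply: le_integral => // x _; rewrite lee_fin.
Qed.

Lemma has_mean_measurable f c : has_mean f c -> measurable_fun setT f.
Proof. by move=> [/integrableP[/measurable_EFinP]]. Qed.

Lemma ge0_has_mean (f : T -> R) : measurable_fun setT f -> (forall x, 0 <= f x) ->
  (\int[P]_x (f x)%:E < +oo)%E -> exists c, has_mean f c.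
Proof.
move=> mf f0 fy.
have fi : P.-integrable setT (EFin \o f).
  apply/integrableP; split; first exact/measurable_EFinP.
  by under eq_integral do rewrite /= ger0_norm//.
by exists (fine (\int[P]_x (f x)%:E)); split => //; rewrite fineK// integrable_fin_num.
Qed.

Lemma has_mean_dominated (f h : T -> R) c : measurable_fun setT f ->
  (forall x, `|f x| <= h x) -> has_mean h c -> exists b, has_mean f b.
Proof.
move=> mf fh [hi _].
have fi : P.-integrable setT (EFin \o f).
  apply: (le_integrable _ _ _ hi) => //; first exact/measurable_EFinP.
  by move=> x _ /=; rewrite lee_fin (le_trans (fh x))// ler_norm.
by exists (fine (\int[P]_x (f x)%:E)); split => //; rewrite fineK// integrable_fin_num.
Qed.

End HasMean.

(** Change of variables along a map that sends P to P'; the two probabilities may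
    live on different presentations of the same sigma-algebra, in which case phi
    is the identity. *)
Lemma has_mean_pullback d d' (T : measurableType d) (T' : measurableType d')
    (R : realType) (P : probability T R) (P' : probability T' R)
    (phi : T -> T') (f : T' -> R) c :
  measurable_fun setT phi ->
  (forall A, measurable A -> P (phi @^-1` A) = P' A) ->
  has_mean P' f c -> has_mean P (f \o phi) c.
Proof.
move=> mphi PE fc; have mf := has_mean_measurable fc.
case: fc => /integrableP[_ fi] fE.
have pE h : (\int[pushforward P phi]_x h x = \int[P']_x h x)%E.
  by apply: eq_measure_integral => A mA _; exact: PE.
have mfE : measurable_fun setT (EFin \o f) by exact/measurable_EFinP.
have i : P.-integrable setT (EFin \o (f \o phi)).
  apply/integrableP; split; first by apply/measurable_EFinP; exact: measurableT_comp.
  by rewrite -pE ge0_integral_pushforward// in fi; exact: measurableT_comp.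
by split => //; rewrite -fE -pE integral_pushforward.
Qed.

Lemma has_mean_fst d d' (T : measurableType d) (T' : measurableType d')
    (R : realType) (P : probability T R) (P' : probability T' R) (f : T -> R) c :
  has_mean P f c -> has_mean (P \x P')%E (f \o fst) c.
Proof.
apply: has_mean_pullback => // A mA; rewrite (_ : fst @^-1` A = A `*` setT).
  rewrite [LHS](product_measure1E P P' mA measurableT).
  transitivity (P A * 1)%E; last exact: mule1.
  by congr (_ * _)%E; exact: probability_setT.
by apply/seteqP; split => x //= [].
Qed.

Lemma has_mean_snd d d' (T : measurableType d) (T' : measurableType d')
    (R : realType) (P : probability T R) (P' : probability T' R) (f : T' -> R) c :
  has_mean P' f c -> has_mean (P \x P')%E (f \o snd) c.
Proof.
apply: has_mean_pullback => // A mA; rewrite (_ : snd @^-1` A = setT `*` A).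
  rewrite [LHS](product_measure1E P P' measurableT mA).
  transitivity (1 * P' A)%E; last exact: mul1e.
  by congr (_ * _)%E; exact: probability_setT.
by apply/seteqP; split => x //= [].
Qed.

(** * Disintegration of a stationary law *)

Section Stationary.
Context (R : realType) (M : 'M[R]_2) (g : 'cV[R]_2).
Variables (noise : probability R R) (nu : probability (R * R)%type R).
Hypothesis nuP : is_stationary_law M g noise nu.

Lemma recursion_stepE x u : recursion_step M g x u =
  (M 0 0 * x.1 + M 0 1 * x.2 + g 0 0 * u, M 1 0 * x.1 + M 1 1 * x.2 + g 1 0 * u).
Proof.
rewrite /recursion_step /col2 /colof !mxE !big_ord_recl !big_ord0 !mxE/=.
by rewrite !addr0 ![u * _]mulrC (_ : lift ord0 ord0 = 1)//; exact/val_inj.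
Qed.

Let step (y : (R * R) * R) := recursion_step M g y.1 y.2.

Lemma measurable_recursion_step : measurable_fun setT step.
Proof.
rewrite (_ : step = fun y => (M 0 0 * y.1.1 + M 0 1 * y.1.2 + g 0 0 * y.2,
    M 1 0 * y.1.1 + M 1 1 * y.1.2 + g 1 0 * y.2)); last first.
  by apply/funext => y; rewrite /step recursion_stepE.
have m11 : measurable_fun setT (fun y : (R * R) * R => y.1.1).
  exact: measurableT_comp.
have m12 : measurable_fun setT (fun y : (R * R) * R => y.1.2).
  exact: measurableT_comp.
apply: measurable_fun_pair => /=.
  apply: measurable_funD; last by apply: measurable_funM.
  by apply: measurable_funD; apply: measurable_funM.
apply: measurable_funD; last by apply: measurable_funM.
by apply: measurable_funD; apply: measurable_funM.
Qed.

(** By the definition of the product measure, stationarity says that nu is the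
    image of nu x noise under the step. *)
Lemma has_mean_step (f : R * R -> R) c : has_mean nu f c ->
  has_mean (nu \x noise)%E (f \o step) c.
Proof.
apply: has_mean_pullback; first exact: measurable_recursion_step.
move=> B mB; rewrite -(nuP mB) /= /product_measure1/=.
apply: eq_integral => x _; congr (noise _).
by apply/seteqP; split => u; rewrite /xsection/= inE.
Qed.

(** Fubini applied to f o step: h is the conditional mean of f after one step. *)
Lemma has_mean_stationary (f : R * R -> R) (h : R * R -> R) c :
  has_mean nu f c ->
  (forall x, has_mean noise (fun u => f (recursion_step M g x u)) (h x)) ->
  has_mean nu h c.
Proof.
move=> /has_mean_step[fi fE] fh.
rewrite -(integral12_prod_meas1 fi) in fE.
have FE : fubini_F noise (EFin \o (f \o step)) = EFin \o h.
  apply/funext => x; exact: (fh x).2.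
by have := integrable_fubini_F fi; rewrite FE in fE *.
Qed.

End Stationary.

(** Sections of the measurable step are measurable, so only the values of the noise law
    on measurable sets enter the invariance equation. *)
Lemma eq_stationary_law (R : realType) (M : 'M[R]_2) (g : 'cV[R]_2)
    (noise : set R -> \bar R) (noise' : probability R R) nu :
  (forall A, measurable A -> noise' A = noise A) ->
  is_stationary_law M g noise nu -> is_stationary_law M g noise' nu.
Proof.
move=> noiseE nuP B mB; rewrite -(nuP B mB); apply: eq_integral => x _.
apply: noiseE; rewrite -[X in measurable X]setTI.
have := @measurableT_comp _ _ _ _ _ _ _ _ _ (measurable_recursion_step M g)
  (pair1_measurable x).
by apply.
Qed.

(** * Integrability from a drift condition *)

(** Here Y and X' are copies of X, and taking expectations in X' <= k Y + N would
    give (1 - k) E[X] <= K if E[X] were known to be finite. Instead compare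
    the bounded variables: min(X', n) <= min(k Y, n) + N gives
    E[min(X, n) - min(k X, n)] <= K, and the nonnegative gap inside the expectation
    increases to (1 - k) X as n grows. *)
Lemma drift_has_mean d d' (T : measurableType d) (T' : measurableType d')
    (R : realType) (P : probability T R) (P' : probability T' R)
    (X : T -> R) (Y X' N : T' -> R) (k K : R) :
  0 <= k < 1 -> measurable_fun setT X -> (forall t, 0 <= X t) ->
  (forall f c, has_mean P (f \o X) c -> has_mean P' (f \o Y) c) ->
  (forall f c, has_mean P (f \o X) c -> has_mean P' (f \o X') c) ->
  (forall t, 0 <= N t) -> has_mean P' N K ->
  (forall t, X' t <= k * Y t + N t) ->
  exists c, has_mean P X c.
Proof.
move=> /andP[k0 k1] mX X0 XY XX' N0 NK X'YN.
pose trunc l (n : nat) (x : R) := Num.min (l * x) n%:R.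
pose gap n t := trunc 1 n (X t) - trunc k n (X t).
have mtrunc l n : measurable_fun setT (trunc l n \o X).
  by apply: measurable_minr => //; apply: measurable_funM.
have mean_trunc l n : 0 <= l -> exists c, has_mean P (trunc l n \o X) c.
  move=> l0; apply: has_mean_dominated (mtrunc l n) _ (has_mean_cst P n%:R) => t /=.
  by rewrite ger0_norm /trunc ?ge_min ?lexx ?orbT// le_min mulr_ge0//=.
have gap_le n : exists2 c, has_mean P (gap n) c & c <= K.
  have [c1 h1] := mean_trunc 1 n ler01; have [c2 h2] := mean_trunc k n k0.
  exists (c1 + -1 * c2).
    by apply: has_mean_ext (has_meanD h1 (has_meanZ (-1) h2)) => // t; rewrite /gap/= mulN1r.
  suff : c1 <= c2 + K by lra.
  apply: (has_mean_le _ (XX' _ _ h1) (has_meanD (XY _ _ h2) NK)) => t /=.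
  rewrite /trunc mul1r; have := X'YN t; have := N0 t.
  by case: (leP (X' t) n%:R); case: (leP (k * Y t) n%:R); lra.
have gap0 n t : 0 <= gap n t.
  rewrite /gap /trunc mul1r subr_ge0; have := X0 t => Xt0.
  have : k * X t <= X t by nra.
  by case: (leP (X t) n%:R); case: (leP (k * X t) n%:R); lra.
have gap_nd t : nondecreasing_seq (fun n => gap n t).
  move=> n m nm; rewrite /gap /trunc mul1r.
  have := X0 t => Xt0; have : k * X t <= X t by nra.
  have : n%:R <= m%:R :> R by rewrite ler_nat.
  by case: (leP (X t) n%:R); case: (leP (k * X t) n%:R);
    case: (leP (X t) m%:R); case: (leP (k * X t) m%:R); lra.
have mgap n : measurable_fun setT (gap n) by apply: measurable_funB; exact: mtrunc.
have gap_lim t : limn (fun n => (gap n t)%:E) = ((1 - k) * X t)%:E.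
  apply/cvg_lim => //; apply: cvg_near_cst; near=> n; rewrite /gap /trunc mul1r.
  have Xn : X t <= n%:R by near: n; exact: nbhs_infty_ger.
  have kXn : k * X t <= n%:R by apply: le_trans Xn; rewrite ler_piMl// ltW.
  by rewrite !min_l// mulrBl mul1r.
have mgapE n : measurable_fun setT (EFin \o gap n) by exact/measurable_EFinP.
have := @cvg_monotone_convergence _ _ _ P _ measurableT (fun n => EFin \o gap n)
  mgapE (fun n t _ => gap0 n t) (fun t _ n m nm => gap_nd t n m nm).
under [X in _ --> X]eq_integral do rewrite gap_lim.
move=> cv; have int_le : (\int[P]_t ((1 - k) * X t)%:E <= K%:E)%E.
  apply: (cvge_to_le cv); near=> n.
  by have [c [_ ->]] := gap_le n; rewrite lee_fin.
have [c hc] : exists c, has_mean P (fun t => (1 - k) * X t) c.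
  apply: ge0_has_mean; first exact: measurable_funM.
    by move=> t; rewrite mulr_ge0// subr_ge0 ltW.
  exact: le_lt_trans int_le (ltry _).
exists ((1 - k)^-1 * c); apply: has_mean_ext (has_meanZ (1 - k)^-1 hc) => // t.
by rewrite mulKf//; lra.
Unshelve. all: by end_near. Qed.

(** * Moments of the normal law *)

(** The Radon-Nikodym derivative satisfies the formula, and p agrees with it
    mu-almost everywhere because both have the same integral on every set. *)
Lemma ge0_integral_density d (T : measurableType d) (R : realType)
    (nu : probability T R) (mu : {sigma_finite_measure set T -> \bar R})
    (p : T -> R) (f : T -> \bar R) :
  measurable_fun setT p -> (forall x, 0 <= p x) ->
  (forall A, measurable A -> nu A = \int[mu]_(x in A) (p x)%:E)%E ->
  measurable_fun setT f -> (forall x, 0 <= f x)%E ->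
  (\int[nu]_x f x = \int[mu]_x (f x * (p x)%:E))%E.
Proof.
move=> mp p0 nuE mf f0.
have mpE : measurable_fun setT (EFin \o p) by exact/measurable_EFinP.
have numu : nu `<< mu.
  apply/null_content_dominatesP => A mA muA0; rewrite nuE//.
  by apply: null_set_integral => //; exact: measurable_funTS.
have mg := measurable_int _ (Radon_Nikodym_SigmaFinite.f_integrable numu).
rewrite -(Radon_Nikodym_SigmaFinite.change_of_variables numu f0)//.
apply: ae_eq_integral => //.
- exact: emeasurable_funM.
- exact: emeasurable_funM.
apply: ae_eqe_mul2l; apply: integral_ae_eq => //.
  exact: Radon_Nikodym_SigmaFinite.f_integrable.
by move=> E _ mE; have <- := Radon_Nikodym_SigmaFinite.f_integral numu mE; exact: nuE.
Qed.

Section GaussianMoments.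
Context (R : realType).

Lemma normal_peakE (s : R) : 0 < s -> normal_peak s = s^-1 * (Num.sqrt (pi *+ 2))^-1.
Proof.
move=> s0; rewrite /normal_peak -mulrnAr sqrtrM ?sqr_ge0// sqrtr_sqr gtr0_norm//.
by rewrite invfM.
Qed.

(** The function is the ratio of the densities of N(m, s'^2) and N(0, s^2), so its
    mean under the latter is the total mass of the former. *)
Lemma normal_likelihood_ratio (m s s' : R) : 0 < s -> 0 < s' ->
  has_mean (normal_prob 0 s) (fun x : R =>
    s / s' * expR (x ^+ 2 / (s ^+ 2 *+ 2) - (x - m) ^+ 2 / (s' ^+ 2 *+ 2))) 1.
Proof.
move=> s0 s'0; set L := (fun x => _).
have sqrt_gt0 : 0 < Num.sqrt (pi *+ 2) :> R by rewrite sqrtr_gt0 mulrn_wgt0// pi_gt0.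
have LpE x : L x * normal_pdf 0 s x = normal_pdf m s' x.
  rewrite !normal_pdfE ?gt_eqF// /L /normal_fun !normal_peakE// subr0.
  have -> : - (x - m) ^+ 2 / (s' ^+ 2 *+ 2) =
      (x ^+ 2 / (s ^+ 2 *+ 2) - (x - m) ^+ 2 / (s' ^+ 2 *+ 2)) +
      - x ^+ 2 / (s ^+ 2 *+ 2) by rewrite !mulNr addrAC subrr add0r.
  by rewrite (expRD (_ - _)); field; rewrite !gt_eqF.
have L0 x : 0 <= L x by rewrite /L mulr_ge0 ?expR_ge0// divr_ge0// ltW.
have mL : measurable_fun (setT : set R) L.
  apply: measurable_funM => //; apply: measurableT_comp => //.
  apply: measurable_funB; apply: measurable_funM => //.
  by apply: measurable_funX; exact: measurable_funB.
have LE : (\int[normal_prob 0 s]_x (L x)%:E = 1)%E.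
  rewrite (@ge0_integral_density _ _ _ _ lebesgue_measure (normal_pdf 0 s))//.
  - by under eq_integral do rewrite -EFinM LpE; exact: integral_normal_pdf.
  - exact: measurable_normal_pdf.
  - exact: normal_pdf_ge0.
  - exact/measurable_EFinP.
have [|c [i E]] := @ge0_has_mean _ _ _ (normal_prob 0 s) L mL L0; first by rewrite LE ltry.
by split.
Qed.

(** By expR y >= 1 + y, the likelihood ratio is at least an affine function of x
    and x ^+ 2; its mean being 1, this bounds the first two moments, with equality at
    m = 0, s' = s, and suitable choices of m and s' pin them down. *)
Lemma normal_moments (s : R) : 0 < s ->
  has_mean (normal_prob 0 s) (fun x : R => x) 0 /\
  has_mean (normal_prob 0 s) (fun x : R => x ^+ 2) (s ^+ 2).
Proof.
move=> s0.
have ratio_ge m s' (x : R) : 0 < s' ->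
    s / s' * (1 + (x ^+ 2 / (s ^+ 2 *+ 2) - (x - m) ^+ 2 / (s' ^+ 2 *+ 2))) <=
    s / s' * expR (x ^+ 2 / (s ^+ 2 *+ 2) - (x - m) ^+ 2 / (s' ^+ 2 *+ 2)).
  by move=> s'0; rewrite ler_wpM2l ?expR_ge1Dx// divr_ge0// ltW.
(* For s' = 2 s and m = 0 the coefficient of x ^+ 2 in the lower bound is positive. *)
have [y hy] : exists y, has_mean (normal_prob 0 s) (fun x : R => x ^+ 2) y.
  have s20 : 0 < 2 * s by lra.
  apply: has_mean_dominated (has_meanZ (16 / 3 * s ^+ 2) (normal_likelihood_ratio 0 s0 s20)).
    exact: measurable_funX.
  move=> x; rewrite ger0_norm ?sqr_ge0//.
  apply: le_trans (ler_wpM2l _ (ratio_ge 0 _ x s20)); last by nra.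
  rewrite subr0 -subr_ge0.
  have -> : 16 / 3 * s ^+ 2 * (s / (2 * s) *
     (1 + (x ^+ 2 / (s ^+ 2 *+ 2) - x ^+ 2 / ((2 * s) ^+ 2 *+ 2)))) - x ^+ 2
     = 8 / 3 * s ^+ 2.
    by field; rewrite gt_eqF.
  by rewrite mulr_ge0 ?sqr_ge0//; lra.
have [b hb] : exists b, has_mean (normal_prob 0 s) (fun x : R => x) b.
  apply: has_mean_dominated (has_meanD (has_mean_cst _ 1) hy) => // x.
  rewrite ler_norml /=; have := sqr_ge0 (x - 1); have := sqr_ge0 (x + 1).
  by move=> ? ?; apply/andP; split; nra.
have ineq m s' : 0 < s' ->
    s / s' * (1 + (y / (s ^+ 2 *+ 2) - (y - 2 * m * b + m ^+ 2) / (s' ^+ 2 *+ 2))) <= 1.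
  move=> s'0.
  refine (has_mean_le (P := normal_prob 0 s) (fun x => ratio_ge m s' x s'0) _ (normal_likelihood_ratio m s0 s'0)).
  apply: has_mean_ext (has_meanD (has_meanD
    (has_mean_cst _ (s / s' * (1 - m ^+ 2 / (s' ^+ 2 *+ 2))))
    (has_meanZ (s / s' * (2 * m / (s' ^+ 2 *+ 2))) hb))
    (has_meanZ (s / s' * ((s ^+ 2 *+ 2)^-1 - (s' ^+ 2 *+ 2)^-1)) hy)).
    by move=> x /=; field; rewrite !gt_eqF.
  by field; rewrite !gt_eqF.
(* s' = s and m = b, the unknown mean itself, leave 1 + b ^+ 2 / (2 s ^+ 2) <= 1. *)
have b0 : b = 0.
  have := ineq b s s0.
  have -> : s / s * (1 + (y / (s ^+ 2 *+ 2) - (y - 2 * b * b + b ^+ 2) / (s ^+ 2 *+ 2)))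
     = 1 + b ^+ 2 / (s ^+ 2 *+ 2) by field; rewrite gt_eqF.
  rewrite gerDl pmulr_lle0 ?invr_gt0 ?mulrn_wgt0 ?exprn_gt0//.
  by move=> b2; apply/eqP; rewrite -sqrf_eq0 eq_le b2 sqr_ge0.
split; first by rewrite b0 in hb.
suff <- : y = s ^+ 2 by [].
have y0 : 0 <= y by apply: has_mean_le (has_mean_cst _ 0) hy => x; exact: sqr_ge0.
(* With m = 0 and s' = s (1 + w) / 2, where w is the second moment in units of
   s ^+ 2, the bound becomes 1 + (w - 1) ^+ 2 / (1 + w) ^+ 3 <= 1. *)
pose w := y / s ^+ 2.
have w0 : 0 <= w by rewrite divr_ge0 ?sqr_ge0.
have yE : y = w * s ^+ 2 by rewrite divfK// sqrf_eq0 gt_eqF.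
have w10 : 0 < 1 + w by lra.
have t0 : 0 < s * ((1 + w) / 2) by rewrite mulr_gt0// divr_gt0.
have := ineq 0 _ t0; rewrite yE.
have -> : s / (s * ((1 + w) / 2)) * (1 + (w * s ^+ 2 / (s ^+ 2 *+ 2) -
   (w * s ^+ 2 - 2 * 0 * b + 0 ^+ 2) / ((s * ((1 + w) / 2)) ^+ 2 *+ 2))) =
   1 + (w - 1) ^+ 2 / (1 + w) ^+ 3.
  by field; rewrite !gt_eqF.
rewrite gerDl pmulr_lle0 ?invr_gt0 ?exprn_gt0// => w1.
suff -> : w = 1 by rewrite mul1r.
by apply/eqP; rewrite -subr_eq0 -sqrf_eq0 eq_le w1 sqr_ge0.
Qed.

Lemma gaussian_law_moments (v : R) (noise : probability R R) : 0 <= v ->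
  (forall A, measurable A -> noise A = gaussian_law 0 v A) ->
  has_mean noise (fun x : R => x) 0 /\ has_mean noise (fun x : R => x ^+ 2) v.
Proof.
move=> v0 noiseE.
have [v_eq0|vN0] := eqVneq v 0.
  have dirac_noise A : measurable A -> noise A = \d_(0 : R) A.
    by move=> /noiseE; rewrite /gaussian_law v_eq0 eqxx.
  have mean_at0 (f : R -> R) : measurable_fun setT f -> has_mean noise f (f 0).
    move=> mf.
    apply: (@has_mean_pullback _ _ _ _ _ _ \d_(0 : R) idfun) => //; first exact: measurable_id.
    have mfE : measurable_fun setT (EFin \o f) by exact/measurable_EFinP.
    split; last by rewrite integral_dirac// diracT mul1e.
    apply/integrableP; split => //; rewrite integral_dirac ?diracT ?mul1e ?ltry//.
    exact: measurableT_comp.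
  split; first exact: mean_at0.
  by rewrite v_eq0 -[X in has_mean _ _ X](expr0n _ 2); apply: mean_at0; exact: measurable_funX.
have s0 : 0 < Num.sqrt v by rewrite sqrtr_gt0 lt_neqAle eq_sym vN0.
have [h1 h2] := normal_moments s0; rewrite sqr_sqrtr// in h2.
(* normal_prob lives on measurableTypeR R, whose measurable sets are those of R. *)
have noiseE' A : measurable A ->
    noise ((idfun : R -> measurableTypeR R) @^-1` A) = normal_prob 0 (Num.sqrt v) A.
  by move=> /noiseE; rewrite /gaussian_law (negbTE vN0).
have mid : measurable_fun setT (idfun : R -> measurableTypeR R).
  by move=> _ A mA; rewrite setTI.
split; [exact: has_mean_pullback mid noiseE' h1|exact: has_mean_pullback mid noiseE' h2].
Qed.
End GaussianMoments.

(** * The energy of the scheme *)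

(** Put y = alpha (w - e), so that y' = e' - e. The first equation reads
    y' + c e' = q y + u. Squaring it and using 2 e' y' = e'^2 + y'^2 - e^2 gives the
    energy balance (1 + c) (y'^2 + c e'^2) = (q y + u)^2 + c e^2. *)
Lemma energy_stepE (R : realFieldType) (alpha c q e w u e' w' : R) :
  alpha != 0 -> 1 + c != 0 ->
  e' = (1 + c)^-1 * (e + q * (alpha * (w - e)) + u) ->
  w' = e' + alpha^-1 * (e' - e) ->
  (alpha * (w' - e')) ^+ 2 + c * e' ^+ 2 =
  (1 + c)^-1 * ((q * (alpha * (w - e)) + u) ^+ 2 + c * e ^+ 2).
Proof.
move=> alpha0 c0 -> ->.
by field; rewrite alpha0 c0.
Qed.

(** Without noise the energy balance contracts by 1 / (1 + c). Young's inequality with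
    parameter c / 2 separates q y from u and keeps the factor below 1. *)
Lemma energy_contraction (R : realFieldType) (alpha c q e w u e' w' : R) :
  alpha != 0 -> 0 < c -> 0 <= q <= 1 ->
  e' = (1 + c)^-1 * (e + q * (alpha * (w - e)) + u) ->
  w' = e' + alpha^-1 * (e' - e) ->
  (alpha * (w' - e')) ^+ 2 + c * e' ^+ 2 <=
  (1 + c / 2) / (1 + c) * ((alpha * (w - e)) ^+ 2 + c * e ^+ 2) +
  (1 + 2 / c) / (1 + c) * u ^+ 2.
Proof.
move=> alpha0 c0 /andP[q0 q1] e'E w'E.
have c1 : 0 < 1 + c by lra.
rewrite (energy_stepE alpha0 _ e'E w'E) ?gt_eqF//.
set y := alpha * (w - e).
rewrite [leRHS](_ : _ = (1 + c)^-1 * ((1 + c / 2) * (y ^+ 2 + c * e ^+ 2) + (1 + 2 / c) * u ^+ 2)); last first.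
  by field; rewrite ?gt_eqF.
apply: ler_wpM2l; first by rewrite invr_ge0 ltW.
have qy : (q * y) ^+ 2 <= y ^+ 2.
  by rewrite exprMn ler_piMl ?sqr_ge0// exprn_ile1.
have young : (q * y + u) ^+ 2 <= (1 + c / 2) * (q * y) ^+ 2 + (1 + 2 / c) * u ^+ 2.
  rewrite -subr_ge0.
  have -> : (1 + c / 2) * (q * y) ^+ 2 + (1 + 2 / c) * u ^+ 2 - (q * y + u) ^+ 2
     = (2 * c)^-1 * (c * (q * y) - 2 * u) ^+ 2 by field; rewrite gt_eqF.
  by rewrite mulr_ge0 ?sqr_ge0// invr_ge0 mulr_ge0// ltW.
have qy2 : (1 + c / 2) * (q * y) ^+ 2 <= (1 + c / 2) * y ^+ 2 by apply: ler_wpM2l; lra.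
have e2 : 0 <= c * c * e ^+ 2 by apply: mulr_ge0; [nra|exact: sqr_ge0].
rewrite -subr_ge0; set N := (1 + 2 / c) * _ in young *.
have -> : (1 + c / 2) * (y ^+ 2 + c * e ^+ 2) + N - ((q * y + u) ^+ 2 + c * e ^+ 2) =
    ((1 + c / 2) * (q * y) ^+ 2 + N - (q * y + u) ^+ 2) +
    ((1 + c / 2) * y ^+ 2 - (1 + c / 2) * (q * y) ^+ 2) + c * c * e ^+ 2 / 2 by ring.
by apply: addr_ge0; [apply: addr_ge0; rewrite subr_ge0|exact: divr_ge0].
Qed.

Lemma coordinates_le_energy (R : realFieldType) (alpha c e w : R) :
  1 <= alpha -> 0 < c ->
  e ^+ 2 + w ^+ 2 <= (2 + 3 / c) * ((alpha * (w - e)) ^+ 2 + c * e ^+ 2).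
Proof.
move=> alpha1 c0.
have y_le : (w - e) ^+ 2 <= (alpha * (w - e)) ^+ 2.
  by rewrite exprMn ler_peMl ?sqr_ge0// exprn_ege1.
rewrite [leRHS](_ : _ = 2 * (alpha * (w - e)) ^+ 2 + 3 * e ^+ 2 +
   (3 * ((alpha * (w - e)) ^+ 2 / c) + 2 * (c * e ^+ 2))); last first.
  by field; rewrite gt_eqF.
have : 0 <= c * e ^+ 2 by apply: mulr_ge0; [exact: ltW|exact: sqr_ge0].
have : 0 <= (alpha * (w - e)) ^+ 2 / c by apply: divr_ge0; [exact: sqr_ge0|exact: ltW].
have := sqr_ge0 (2 * e - w).
move: y_le; set Y := (alpha * _) ^+ 2; set Yc := Y / c; set E := c * _.
by move=> *; nra.
Qed.

Lemma sum_ord2 (V : nmodType) (F : 'I_2 -> V) : \sum_i F i = F 0 + F 1.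
Proof.
rewrite !big_ord_recl big_ord0 addr0; congr (F _ + F _); exact/val_inj.
Qed.

Lemma col2_step (R : realType) (M : 'M[R]_2) (g : 'cV[R]_2) x u :
  col2 (recursion_step M g x u) = M *m col2 x + u *: g.
Proof.
apply/colP => i; rewrite /recursion_step mxE /=.
by case: i => -[|[|//]] i2 /=; congr (fun_of_matrix _ _ _); exact/val_inj.
Qed.

Lemma col2_sqr_le (R : realDomainType) (x : R * R) i :
  col2 x i 0 ^+ 2 <= x.1 ^+ 2 + x.2 ^+ 2.
Proof.
by case: i => -[|[|//]] i2; rewrite mxE/= ?lerDl ?lerDr sqr_ge0.
Qed.

Lemma ord2E (i : 'I_2) : i = 0 \/ i = 1.
Proof. by case: i => -[|[|//]] i2; [left|right]; exact/val_inj. Qed.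

Lemma measurable_col2 (R : realType) i :
  measurable_fun setT (fun x : R * R => col2 x i 0).
Proof.
have [->|->] := ord2E i.
  have -> : (fun x : R * R => col2 x 0 0) = fst by apply/funext => x; rewrite mxE.
  exact: measurable_fst.
have -> : (fun x : R * R => col2 x 1 0) = snd by apply/funext => x; rewrite mxE.
exact: measurable_snd.
Qed.

(** * Moments of a stationary law *)

Section StationaryMoments.
Context (R : realType) (M : 'M[R]_2) (g : 'cV[R]_2) (v : R).
Variables (noise : probability R R) (nu : probability (R * R)%type R).
Hypothesis nuP : is_stationary_law M g noise nu.
Hypothesis noise1 : has_mean noise (fun u => u) 0.
Hypothesis noise2 : has_mean noise (fun u => u ^+ 2) v.

Lemma has_mean_affine_noise p q : has_mean noise (fun u => p + u * q) p.
Proof.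
apply: has_mean_ext (has_meanD (has_mean_cst _ p) (has_meanZ q noise1)).
  by move=> u /=; rewrite mulrC.
by rewrite mulr0 addr0.
Qed.

Lemma has_mean_quadratic_noise p q p' q' :
  has_mean noise (fun u => (p + u * q) * (p' + u * q')) (p * p' + v * (q * q')).
Proof.
apply: has_mean_ext (has_meanD (has_meanD (has_mean_cst _ (p * p'))
  (has_meanZ (p * q' + q * p') noise1)) (has_meanZ (q * q') noise2)).
  by move=> u /=; ring.
by ring.
Qed.

Lemma stationary_mean (m : 'cV[R]_2) :
  (forall i, has_mean nu (fun x => col2 x i 0) (m i 0)) -> m = M *m m.
Proof.
move=> hm; apply/colP => i.
have hMm : has_mean nu (fun x => (M *m col2 x) i 0) ((M *m m) i 0).
  apply: has_mean_ext (has_meanD (has_meanZ (M i 0) (hm 0)) (has_meanZ (M i 1) (hm 1))).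
    by move=> x; rewrite [RHS]mxE sum_ord2.
  by rewrite [RHS]mxE sum_ord2.
apply: has_mean_unique _ hMm; apply: (has_mean_stationary nuP (hm i)) => x.
apply: has_mean_ext (has_mean_affine_noise _ (g i 0)) => // u /=.
by rewrite col2_step !mxE.
Qed.

Lemma stationary_second_moment (S : 'M[R]_2) :
  (forall i j, has_mean nu (fun x => col2 x i 0 * col2 x j 0) (S i j)) ->
  S = M *m S *m M^T + v *: (g *m g^T).
Proof.
move=> hS; apply/matrixP => i j.
have hMS : has_mean nu
    (fun x => (M *m col2 x) i 0 * (M *m col2 x) j 0 + v * (g i 0 * g j 0))
    ((M *m S *m M^T + v *: (g *m g^T)) i j).
  apply: has_mean_ext (has_meanD (has_meanD
      (has_meanD (has_meanZ (M i 0 * M j 0) (hS 0 0)) (has_meanZ (M i 0 * M j 1) (hS 0 1)))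
      (has_meanD (has_meanZ (M i 1 * M j 0) (hS 1 0)) (has_meanZ (M i 1 * M j 1) (hS 1 1))))
      (has_mean_cst _ (v * (g i 0 * g j 0)))).
    move=> x; rewrite [(_ *m _) i 0]mxE [(_ *m _) j 0]mxE !sum_ord2 /=.
    by move: (col2 x 0 0) (col2 x 1 0) => a b; ring.
  rewrite !mxE sum_ord2 big_ord1 !mxE !sum_ord2.
  by ring.
apply: has_mean_unique _ hMS; apply: (has_mean_stationary nuP (hS i j)) => x.
apply: has_mean_ext (has_mean_quadratic_noise _ (g i 0) _ (g j 0)) => // u /=.
by rewrite col2_step !mxE.
Qed.

(** The drift lemma on the product space, with the current state x and the next
    state M x + g u as the two copies. *)
Lemma stationary_drift_has_mean (V : R * R -> R) (k C : R) :
  0 <= k < 1 -> 0 <= C -> measurable_fun setT V -> (forall x, 0 <= V x) ->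
  (forall x u, V (recursion_step M g x u) <= k * V x + C * u ^+ 2) ->
  exists c, has_mean nu V c.
Proof.
move=> k01 C0 mV V0 Vstep.
pose step (y : R * R * R) := recursion_step M g y.1 y.2.
apply: (@drift_has_mean _ _ _ _ _ nu (nu \x noise)%E V (V \o fst) (V \o step)
  (fun y => C * y.2 ^+ 2) k (C * v)) => //.
- by move=> f c fc; exact: (has_mean_fst noise fc).
- by move=> f c fc; exact: (has_mean_step nuP fc).
- by move=> y; rewrite mulr_ge0 ?sqr_ge0.
- exact: (has_meanZ C (has_mean_snd nu noise2)).
- by move=> y; exact: Vstep.
Qed.

End StationaryMoments.

Lemma covariance_centered d (T : measurableType d) (R : realType)
    (P : probability T R) (X Y : T -> R) c :
  has_mean P X 0 -> has_mean P Y 0 -> has_mean P (fun t => X t * Y t) c ->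
  covariance P X Y = c%:E.
Proof.
move=> [_ X0] [_ Y0] [_ XY].
have EX : 'E_P[X]%E = 0%E by rewrite unlock.
have EY : 'E_P[Y]%E = 0%E by rewrite unlock.
rewrite covariance.unlock EX EY unlock -XY; apply: eq_integral => t _.
by transitivity ((X t - 0) * (Y t - 0))%:E => //; rewrite !subr0.
Qed.

Lemma Lfun2_has_mean d (T : measurableType d) (R : realType)
    (P : probability T R) (X : T -> R) c :
  measurable_fun setT X -> has_mean P (fun t => X t ^+ 2) c -> X \in Lfun P 2%:E.
Proof.
move=> mX [_ EX2]; rewrite inE; apply/andP; split; rewrite inE //=.
rewrite /finite_norm unlock poweR_lty//.
under eq_integral => t _ do rewrite /= powR_mulrn// real_normK ?num_real//.
by rewrite EX2 ltry.
Qed.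

(** * The Lyapunov equation as a linear system *)

(** X and M X M^T + Q are symmetric, so the matrix equation amounts to its entries
    (0, 0), (0, 1) and (1, 1), which are the rows of the system. *)
Lemma lyapunov_system (R : realType) (a b c d x11 x12 x22 q11 q12 q22 : R) :
  let M : 'M[R]_2 := mxof 2 2 [:: [:: a; b]; [:: c; d]] in
  let X : 'M[R]_2 := mxof 2 2 [:: [:: x11; x12]; [:: x12; x22]] in
  let Q : 'M[R]_2 := mxof 2 2 [:: [:: q11; q12]; [:: q12; q22]] in
  let L : 'M[R]_3 := mxof 3 3
    [:: [:: 1 - a ^+ 2; - (2 * a * b); - b ^+ 2];
        [:: - (a * c); 1 - (a * d + b * c); - (b * d)];
        [:: - c ^+ 2; - (2 * c * d); 1 - d ^+ 2]] in
  X = M *m X *m M^T + Q <->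
  L *m colof 3 [:: x11; x12; x22] = colof 3 [:: q11; q12; q22].
Proof.
move=> M X Q L; split => [/matrixP eqX|/matrixP eqL].
  have := eqX 0 0; have := eqX 0 1; have := eqX 1 1.
  rewrite !mxE !sum_ord2 !mxE !sum_ord2 !mxE /= => e22 e12 e11.
  apply/colP => i; rewrite !mxE !big_ord_recl big_ord0 !mxE.
  by case: i => -[|[|[|//]]] ilt /=; lra.
have := eqL 0 0; have := eqL 1 0; have := eqL (Ordinal (ltnSn 2)) 0.
rewrite !mxE !big_ord_recl !big_ord0 !mxE /= => e22 e12 e11.
apply/matrixP => i j; rewrite !mxE !sum_ord2 !mxE !sum_ord2 !mxE.
by case: i => -[|[|//]] ilt; case: j => -[|[|//]] jlt /=; lra.
Qed.

(** * The stationary law of the scheme *)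

Theorem mainTheorem5 (R : realType) (a mu gamma alpha rho : R)
    (d : measure_display) (T : measurableType d) (Pr : probability T R)
    (z : nat -> {RV Pr >-> (R * R)%type})
    (xi : nat -> {RV Pr >-> R}) :
  0 < mu -> mu <= a -> 0 < gamma -> 1 <= alpha -> 0 <= rho ->
  let tau := 1 / alpha + mu / gamma in
  let s := 1 + tau in
  let lambda := alpha / (gamma * s) in
  let r := 1 / (1 + lambda * a) in
  let a1 := r * tau / s in
  let b1 := r / s in
  let c1 := (1 + 1 / alpha) * a1 - 1 / alpha in
  let d1 := (1 + 1 / alpha) * b1 in
  let M : 'M[R]_2 := mxof 2 2 [:: [:: a1; b1]; [:: c1; d1]] in
  let g : 'cV[R]_2 := r *: colof 2 [:: 1; 1 + 1 / alpha] in
  let v := alpha * rho ^+ 2 / s ^+ 2 in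
  let q11 := v * r ^+ 2 in
  let q12 := v * r ^+ 2 * (1 + 1 / alpha) in
  let q22 := v * r ^+ 2 * (1 + 1 / alpha) ^+ 2 in
  let L : 'M[R]_3 := mxof 3 3
    [:: [:: 1 - a1 ^+ 2; - (2 * a1 * b1); - b1 ^+ 2];
        [:: - (a1 * c1); 1 - (a1 * d1 + b1 * c1); - (b1 * d1)];
        [:: - c1 ^+ 2; - (2 * c1 * d1); 1 - d1 ^+ 2]] in
  mutually_independent Pr (fun k => xi k : T -> R) ->
  (forall k (A : set R), measurable A ->
     distribution Pr (xi k) A = gaussian_law 0 v A) ->
  (forall k, independent_pair Pr (xi k)
     (fun t => [tuple z i t | i < k.+1])) ->
  (forall k t, z k.+1 t = recursion_step M g (z k t) (xi k t)) ->
  spectral_radius M < 1 ->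
  forall k : nat,
  is_stationary_law M g (gaussian_law 0 v) (distribution Pr (z k)) ->
  let e : T -> R := fun t => (z k t).1 in
  let w : T -> R := fun t => (z k t).2 in
  let Z : T -> 'cV[R]_2 := fun t => col2 (z k t) in
  let P : 'M[R]_2 := covariance_mx Pr Z in
  let p11 := P 0 0 in
  let p12 := P 0 1 in
  let p22 := P 1 1 in
  let Q : 'M[R]_2 := fine 'V_Pr[xi k] *: (g *m g^T) in
  [/\ (e \in Lfun Pr 2%:E /\ w \in Lfun Pr 2%:E),
      ('E_Pr[e] = 0 /\ 'E_Pr[w] = 0)%E,
      (P = expectation_mx Pr (fun t => Z t *m (Z t)^T) /\
       P = mxof 2 2 [:: [:: p11; p12]; [:: p12; p22]]),
      (P = M *m P *m M^T + Q /\ 'E_Pr[(fun t => e t ^+ 2)%R]%E = p11%:E) &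
      (L *m colof 3 [:: p11; p12; p22] = colof 3 [:: q11; q12; q22] /\
       (forall x11 x12 x22 : R,
          let X : 'M[R]_2 := mxof 2 2 [:: [:: x11; x12]; [:: x12; x22]] in
          X = M *m X *m M^T + Q <->
          L *m colof 3 [:: x11; x12; x22] = colof 3 [:: q11; q12; q22]))].
Proof.
move=> mu0 mua gamma0 alpha1 rho0 tau s lambda r a1 b1 c1 d1 M g v q11 q12 q22 L.
move=> _ xi_law _ _ _ k nuP e w Z P p11 p12 p22 Q.
have alpha0 : 0 < alpha by lra.
have tau0 : 0 < tau by rewrite addr_gt0 ?divr_gt0.
have s0 : 0 < s by rewrite addr_gt0.
(* The energy parameter: r = 1 / (1 + c). *)
pose c := lambda * a.
have c0 : 0 < c by rewrite !mulr_gt0 ?invr_gt0 ?mulr_gt0//; lra.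
have rE : r = (1 + c)^-1 by rewrite /r div1r.
have v0 : 0 <= v by rewrite !mulr_ge0 ?sqr_ge0 ?invr_ge0 ?sqr_ge0// ltW.
pose noise : probability R R := distribution Pr (xi k).
pose nu : probability (R * R)%type R := distribution Pr (z k).
have [noise1 noise2] : has_mean noise (fun u : R => u) 0 /\
    has_mean noise (fun u : R => u ^+ 2) v.
  by apply: gaussian_law_moments => // A mA; exact: xi_law.
have {}nuP : is_stationary_law M g noise nu by exact: eq_stationary_law (xi_law k) nuP.
pose V (x : R * R) := (alpha * (x.2 - x.1)) ^+ 2 + c * x.1 ^+ 2.
have V0 x : 0 <= V x.
  by apply: addr_ge0; [exact: sqr_ge0|apply: mulr_ge0; [exact: ltW|exact: sqr_ge0]].
have mV : measurable_fun setT V.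
  apply: measurable_funD.
    by apply: measurable_funX; apply: measurable_funM => //; exact: measurable_funB.
  by apply: measurable_funM => //; exact: measurable_funX.
have [EV hV] : exists EV, has_mean nu V EV.
  apply: (@stationary_drift_has_mean _ M g v noise nu nuP noise2 V
    ((1 + c / 2) / (1 + c)) ((1 + 2 / c) / (1 + c))) => //.
  - by rewrite divr_ge0 ?ltr_pdivrMr; lra.
  - by rewrite divr_ge0 ?addr_ge0 ?divr_ge0//; lra.
  (* The scheme has extrapolation parameter q = 1 / (alpha s), and the noise enters as u. *)
  move=> x u; apply: (@energy_contraction _ alpha c (alpha * s)^-1); rewrite ?gt_eqF//.
  - have s1 : 1 <= s by rewrite lerDl ltW.
    by rewrite invr_ge0 (invf_le1 (mulr_gt0 alpha0 s0)) mulr_ege1// ltW// mulr_gt0.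
  - rewrite recursion_stepE !mxE /= -rE /a1 /b1 /s.
    by field; rewrite ?gt_eqF.
  - rewrite recursion_stepE !mxE /= /c1 /d1.
    by field; rewrite ?gt_eqF.
(* Coordinates and their products are dominated by 1 + V up to a factor. *)
have [m hm] : exists m : 'cV[R]_2, forall i, has_mean nu (fun x => col2 x i 0) (m i 0).
  have /choice[f hf] i : exists c, has_mean nu (fun x => col2 x i 0) c.
    apply: has_mean_dominated (measurable_col2 i) _
      (has_meanD (has_mean_cst _ 1) (has_meanZ (2 + 3 / c) hV)) => x /=.
    have := coordinates_le_energy x.1 x.2 alpha1 c0; have := col2_sqr_le x i.
    rewrite -/(V x) ler_norml; set y := col2 x i 0; set KV := _ * V x => y1 y2.
    by have := sqr_ge0 (y - 1); have := sqr_ge0 (y + 1) => *; apply/andP; split; nra.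
  by exists (\col_i f i) => i; rewrite mxE.
have [S hS] : exists S : 'M[R]_2,
    forall i j, has_mean nu (fun x => col2 x i 0 * col2 x j 0) (S i j).
  have /choice[f hf] (ij : 'I_2 * 'I_2) :
      exists c, has_mean nu (fun x => col2 x ij.1 0 * col2 x ij.2 0) c.
    apply: has_mean_dominated _ _ (has_meanZ (2 + 3 / c) hV) => [|x].
      by apply: measurable_funM; exact: measurable_col2.
    have := coordinates_le_energy x.1 x.2 alpha1 c0.
    have := col2_sqr_le x ij.1; have := col2_sqr_le x ij.2.
    rewrite -/(V x) ler_norml; set y := col2 x ij.1 0; set y' := col2 x ij.2 0.
    set KV := _ * V x => *.
    by have := sqr_ge0 (y - y'); have := sqr_ge0 (y + y') => *; apply/andP; split; lra.
  by exists (\matrix_(i, j) f (i, j)) => i j; rewrite mxE; exact: (hf (i, j)).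
(* The second row of m = M m gives m 1 0 = m 0 0, then the first one gives
   m 0 0 = r * m 0 0, as a1 + b1 = r. *)
have m0 : m = 0.
  have /matrixP mE := stationary_mean nuP noise1 hm.
  have := mE 0 0; have := mE 1 0; rewrite !mxE !sum_ord2 !mxE /= => m1E m0E.
  have m10 : m 1 0 = m 0 0.
    rewrite m1E /c1 /d1 -[RHS]mul1r.
    transitivity ((1 + 1 / alpha) * (a1 * m 0 0 + b1 * m 1 0) - 1 / alpha * m 0 0); first by ring.
    by rewrite -m0E; ring.
  have m00 : c * m 0 0 = 0.
    have ab : a1 + b1 = r by rewrite /a1 /b1 /s; field; rewrite gt_eqF.
    have rm : m 0 0 = r * m 0 0 by rewrite -ab mulrDl {1}m0E m10.
    have c1N0 : 1 + c != 0 by rewrite gt_eqF// addr_gt0.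
    apply: (@addrI _ (m 0 0)); rewrite addr0 -{1}[m 0 0]mul1r -mulrDl.
    by rewrite {1}rm rE mulrA divff// mul1r.
  have {}m00 : m 0 0 = 0.
    by apply/eqP; move/eqP: m00; rewrite mulf_eq0 (gt_eqF c0).
  apply/colP => i; rewrite [RHS]mxE.
  by have [->|->] := ord2E i; rewrite ?m10.
have SE := stationary_second_moment nuP noise1 noise2 hS.
have {}hm i : has_mean Pr (fun t => Z t i 0) 0.
  by have := hm i; rewrite m0 mxE => h; exact: (has_mean_pullback _ _ h).
have {}hS i j : has_mean Pr (fun t => Z t i 0 * Z t j 0) (S i j).
  exact: (has_mean_pullback _ _ (hS i j)).
have PE : P = S.
  by apply/matrixP => i j; rewrite mxE (covariance_centered (hm i) (hm j) (hS i j)).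
have xi1 : has_mean Pr (xi k) 0 by exact: (has_mean_pullback _ _ noise1).
have xi2 : has_mean Pr (fun t => xi k t * xi k t) v.
  exact: (has_mean_pullback _ _ noise2).
have QE : Q = v *: (g *m g^T) by rewrite /Q /variance (covariance_centered xi1 xi1 xi2).
have Qmx : Q = mxof 2 2 [:: [:: q11; q12]; [:: q12; q22]].
  rewrite QE; apply/matrixP => i j; rewrite !mxE big_ord1 !mxE.
  by have [->|->] := ord2E i; have [->|->] := ord2E j;
    rewrite /= /q11 /q12 /q22; ring.
have PX : P = mxof 2 2 [:: [:: p11; p12]; [:: p12; p22]].
  apply/matrixP => i j; rewrite [RHS]mxE.
  have [->|->] := ord2E i; have [->|->] := ord2E j => //=.
  by rewrite /p12 ![P _ _]mxE covarianceC.
have Plyap : P = M *m P *m M^T + Q by rewrite QE PE -SE.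
have system := lyapunov_system a1 b1 c1 d1 _ _ _ q11 q12 q22.
have Z0 t : Z t 0 0 = e t by rewrite mxE.
have Z1 t : Z t 1 0 = w t by rewrite mxE.
have he2 : has_mean Pr (fun t => e t ^+ 2) p11.
  by rewrite /p11 PE; apply: has_mean_ext (hS 0 0) => // t; rewrite Z0.
have hw2 : has_mean Pr (fun t => w t ^+ 2) p22.
  by rewrite /p22 PE; apply: has_mean_ext (hS 1 1) => // t; rewrite Z1.
have he : has_mean Pr e 0 by apply: has_mean_ext (hm 0).
have hw : has_mean Pr w 0 by apply: has_mean_ext (hm 1).
split.
- split; first exact: Lfun2_has_mean (has_mean_measurable he) he2.
  exact: Lfun2_has_mean (has_mean_measurable hw) hw2.
- by rewrite unlock; split; [exact: he.2|exact: hw.2].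
- split=> //; rewrite PE; apply/matrixP => i j.
  have ZZ : (fun t => (Z t *m (Z t)^T) i j) = (fun t => Z t i 0 * Z t j 0).
    by apply/funext => t; rewrite mxE big_ord1 [_^T _ _]mxE.
  rewrite [RHS]mxE ZZ unlock; have [_] := hS i j.
  by move=> ->.
- by split => //; rewrite unlock; exact: he2.2.
- split; last by move=> x11 x12 x22 X; rewrite Qmx; exact: system.
  by apply/system; rewrite -PX -Qmx.
Qed.
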